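(* Let $\mathscr{A}$ be a unital $C^*$-algebra, $\mathscr{E}$ a Hilbert $\mathscr{A}$-module, $\mathscr{E}_1,\mathscr{E}_2$ ternary subspaces of $\mathscr{E}$, and let $z\in\mathscr{E}_1\cap\mathscr{E}_2$ be such that $\langle z,z\rangle=1$. Then $\mathscr{E}_1$ and $\mathscr{E}_2$ are module independent if and only if the $C^*$-subalgebras $\mathscr{A}_1=\langle\mathscr{E}_1,\mathscr{E}_1\rangle$ and $\mathscr{A}_2=\langle\mathscr{E}_2,\mathscr{E}_2\rangle$ of $\mathscr{A}$ are $C^*$-independent.
   Context: A state on a $C^*$-algebra is a positive linear functional of norm one; $S(\mathscr{B})$ is the set of states of $\mathscr{B}$. Hilbert $C^*$-modules are right modules with $\mathscr{A}$-valued inner product $\langle\cdot,\cdot\rangle$, $\mathscr{A}$-linear in the second variable, and $\|x\|=\|\langle x,x\rangle\|^{1/2}$; for $x\in\mathscr{E}$, $|x|=\langle x,x\rangle^{1/2}\in\mathscr{A}$. For a closed subspace $\mathscr{F}\subseteq\mathscr{E}$, $\langle\mathscr{F},\mathscr{F}\rangle$ is the closed linear span of $\{\langle x,y\rangle:x,y\in\mathscr{F}\}$. A closed subspace $\mathscr{F}$ of $\mathscr{E}$ is ternary if $\mathscr{F}\langle\mathscr{F},\mathscr{F}\rangle\subseteq\mathscr{F}$; then $\langle\mathscr{F},\mathscr{F}\rangle$ is a $C^*$-subalgebra of $\mathscr{A}$. Ternary subspaces $\mathscr{E}_1,\mathscr{E}_2$ of $\mathscr{E}$ are (Hilbert $C^*$-)module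 independent if there are constants $m,M>0$ such that for all states $\varphi_i\in S(\langle\mathscr{E}_i,\mathscr{E}_i\rangle)$, $i=1,2$, there is a state $\varphi\in S(\mathscr{A})$ with $m\,\varphi_i(|x|)\le\varphi(|x|)\le M\,\varphi_i(|x|^2)^{1/2}$ for all $x\in\mathscr{E}_i$, $i=1,2$. $C^*$-independence: $C^*$-subalgebras $\mathscr{A}_1,\mathscr{A}_2$ of $\mathscr{A}$ (all with the same identity) are $C^*$-independent if for every state $\varphi_1$ of $\mathscr{A}_1$ and every state $\varphi_2$ of $\mathscr{A}_2$ there is a state $\varphi$ of $\mathscr{A}$ extending both. *)

(* Defs.v *)
From HB Require Import structures.
From mathcomp Require Import all_boot all_order all_algebra.
From mathcomp Require Import complex.
From mathcomp Require Import all_classical all_reals all_analysis.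
Set Implicit Arguments.
Unset Strict Implicit.
Unset Printing Implicit Defensive.
Import Order.TTheory GRing.Theory Num.Theory.
Import numFieldNormedType.Exports.

Local Open Scope classical_set_scope.
Local Open Scope complex_scope.
Local Open Scope ring_scope.

(* The norm of a normedModType over R[i] takes its values in R[i] (they are
   nonnegative reals), and z <= w on R[i] means that w - z is a nonnegative
   real.
   The multiplication of a C*-algebra is an explicit operation, because HB
   does not allow a structure joining GRing.PzSemiRing and
   Num.SemiNormedZmodule to be added after Num.NumDomain. *)
HB.mixin Record isUnitalCstarAlgebra (R : realType) A
    of CompleteNormedModule R[i] A := {
  cmul : A -> A -> A ;
  cone : A ;
  star : A -> A ;
  cmulA : associative cmul ;
  cmul1l : left_id cone cmul ;
  cmul1r : right_id cone cmul ;
  cmulDl : left_distributive cmul +%R ;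
  cmulDr : right_distributive cmul +%R ;
  cmulZl : forall (c : R[i]) a b, cmul (c *: a) b = c *: cmul a b ;
  cmulZr : forall (c : R[i]) a b, cmul a (c *: b) = c *: cmul a b ;
  starK : involutive star ;
  starD : forall a b, star (a + b) = star a + star b ;
  starZ : forall (c : R[i]) a, star (c *: a) = c^*%C *: star a ;
  starM : forall a b, star (cmul a b) = cmul (star b) (star a) ;
  norm_cmul : forall a b : A, `|cmul a b| <= `|a| * `|b| ;
  norm_starM : forall a : A, `|cmul (star a) a| = `|a| ^+ 2
}.

#[short(type="unitalCstarAlgType")]
HB.structure Definition UnitalCstarAlgebra (R : realType) :=
  {A of CompleteNormedModule R[i] A & isUnitalCstarAlgebra R A}.

Section CstarAlgebras.
Context {R : realType} {A : unitalCstarAlgType R}.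
Implicit Types (a b : A) (B : set A) (phi : A -> R[i]).

Definition cstar_pos a := exists b, a = cmul (star b) b.

(* The unique positive square root of a positive element. *)
Definition cstar_sqrt a : A := xget 0 [set b | cstar_pos b /\ cmul b b = a].

(* A functional on a C*-subalgebra B of A is represented by a function on A,
   of which only the values on B matter. *)
Definition linear_on B phi :=
  forall (c : R[i]) a b, B a -> B b -> phi (c *: a + b) = c * phi a + phi b.

Definition positive_on B phi := forall b, B b -> 0 <= phi (cmul (star b) b).

Definition norm_on B phi : \bar R :=
  ereal_sup [set (complex.Re `|phi b|)%:E | b in B `&` [set b | `|b| <= 1]].

Definition is_state B phi :=
  [/\ linear_on B phi, positive_on B phi & norm_on B phi = 1%E].

Definition cstar_independent B1 B2 :=
  forall phi1 phi2, is_state B1 phi1 -> is_state B2 phi2 ->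
  exists phi, [/\ is_state [set: A] phi,
    forall b, B1 b -> phi b = phi1 b & forall b, B2 b -> phi b = phi2 b].

End CstarAlgebras.

(* An lmodType structure over the converse ring of A would conflict with the
   one over R[i], so the right action of A is an explicit operation as well. *)
HB.mixin Record isHilbertModule (R : realType) (A : unitalCstarAlgType R) E
    of CompleteNormedModule R[i] E := {
  ract : E -> A -> E ;
  inner : E -> E -> A ;
  ractDl : forall x y a, ract (x + y) a = ract x a + ract y a ;
  ractDr : forall x a b, ract x (a + b) = ract x a + ract x b ;
  ractM : forall x a b, ract x (cmul a b) = ract (ract x a) b ;
  ract1 : forall x, ract x cone = x ;
  ractZl : forall (c : R[i]) x a, ract (c *: x) a = c *: ract x a ;
  ractZr : forall (c : R[i]) x a, ract x (c *: a) = c *: ract x a ;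
  innerDr : forall x y z, inner x (y + z) = inner x y + inner x z ;
  innerZr : forall (c : R[i]) x y, inner x (c *: y) = c *: inner x y ;
  inner_ract : forall x y a, inner x (ract y a) = cmul (inner x y) a ;
  star_inner : forall x y, star (inner x y) = inner y x ;
  inner_pos : forall x, cstar_pos (inner x x) ;
  inner_eq0 : forall x, inner x x = 0 -> x = 0 ;
  sqr_norm_inner : forall x : E, `|x| ^+ 2 = `|inner x x|
}.

#[short(type="hilbertModType")]
HB.structure Definition HilbertModule (R : realType)
    (A : unitalCstarAlgType R) :=
  {E of CompleteNormedModule R[i] E & isHilbertModule R A E}.

Section LinearSpan.
Context {K : numFieldType} {V : normedModType K}.

Definition linear_subspace (M : set V) :=
  M 0 /\ forall (c : K) u v, M u -> M v -> M (c *: u + v).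

Definition closed_linear_span (S : set V) : set V :=
  closure (smallest linear_subspace S).

End LinearSpan.

Section HilbertModules.
Context {R : realType} {A : unitalCstarAlgType R} {E : hilbertModType A}.
Implicit Types (x : E) (F : set E).

Definition mod_abs x : A := cstar_sqrt (inner x x).

Definition inner_span F : set A :=
  closed_linear_span [set inner x y | x in F & y in F].

Definition ternary F :=
  [/\ linear_subspace F, closed F
    & forall x a, F x -> inner_span F a -> F (ract x a)].

Definition module_independent (E1 E2 : set E) :=
  exists m M : R, [/\ 0 < m, 0 < M &
    forall phi1 phi2 : A -> R[i],
      is_state (inner_span E1) phi1 -> is_state (inner_span E2) phi2 ->
      exists phi : A -> R[i], [/\ is_state [set: A] phi,
        forall x, E1 x ->
          m%:C * phi1 (mod_abs x) <= phi (mod_abs x)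
            <= M%:C * sqrtC (phi1 (cmul (mod_abs x) (mod_abs x))) &
        forall x, E2 x ->
          m%:C * phi2 (mod_abs x) <= phi (mod_abs x)
            <= M%:C * sqrtC (phi2 (cmul (mod_abs x) (mod_abs x)))]].

End HilbertModules.

(* Main.v *)
(** Since [<z, z> = 1], every positive element [h] of [A_i = <E_i, E_i>] is
    [|z h|] with [z h] in [E_i], and conversely [|x|] is a positive element of
    [A_i] for [x] in [E_i]; so module independence only speaks of the positive
    elements of [A_1] and [A_2].

    If [A_1], [A_2] are C*-independent, a common extension of [phi_1], [phi_2]
    works with [m = M = 1], by the Cauchy-Schwarz inequality.

    Conversely, by M. Riesz's extension theorem a common extension of [phi_1]
    and [phi_2] exists as soon as [a + b >= 0] implies
    [phi_1 a + phi_2 b >= 0], for self-adjoint [a] in [A_1], [b] in [A_2]. Let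
    [- alpha] and [- beta] be the minima of the spectra of [a] and [b], attained
    by states [psi_1] and [psi_2]. A state [phi] given by module independence
    for [psi_1], [psi_2] satisfies
    [phi (alpha + a) <= M psi_1 ((alpha + a)^2)^(1/2) = 0], and likewise
    [phi (beta + b) = 0]; hence [0 <= phi (a + b) = - alpha - beta], which is at
    most [phi_1 a + phi_2 b]. *)

From HB Require Import structures.
Require Import Defs.
From mathcomp Require Import all_boot all_order all_algebra.
From mathcomp Require Import complex ring lra.
From mathcomp Require Import all_classical all_reals all_analysis.

Set Implicit Arguments.
Unset Strict Implicit.
Unset Printing Implicit Defensive.
Import Order.TTheory GRing.Theory Num.Theory.
Import numFieldNormedType.Exports.

Local Open Scope classical_set_scope.
Local Open Scope complex_scope.
Local Open Scope ring_scope.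

(** * Real-valued norms, limits and closed sets *)

Section RealNorm.
Context {R : realType} {V : normedModType R[i]}.
Implicit Types (u v : V) (C : set V) (r : R).

(** The norm is a nonnegative real inside [R[i]]; taking its real part loses nothing and lands in
    the totally ordered field [R]. *)
Definition rnorm v : R := complex.Re `|v|.

Lemma rnormE v : `|v| = (rnorm v)%:C.
Proof. by rewrite RRe_real // ger0_real. Qed.

Lemma rnorm_ge0 v : 0 <= rnorm v.
Proof. by rewrite -lecR -rnormE normr_ge0. Qed.

Lemma rnorm0 : rnorm (0 : V) = 0.
Proof. by rewrite /rnorm normr0. Qed.

Lemma rnorm_eq0 v : rnorm v = 0 -> v = 0.
Proof. by move=> v0; apply/normr0_eq0; rewrite rnormE v0. Qed.

Lemma rnormN v : rnorm (- v) = rnorm v.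
Proof. by rewrite /rnorm normrN. Qed.

Lemma rnorm_distC u v : rnorm (u - v) = rnorm (v - u).
Proof. by rewrite -rnormN opprB. Qed.

Lemma ler_rnormD u v : rnorm (u + v) <= rnorm u + rnorm v.
Proof. by rewrite -lecR rmorphD /= -!rnormE ler_normD. Qed.

Lemma rnormZ (c : R[i]) v : rnorm (c *: v) = complex.Re `|c| * rnorm v.
Proof.
have cE : `|c| = (complex.Re `|c|)%:C by rewrite RRe_real // ger0_real.
by rewrite {1}/rnorm normrZ rnormE {1}cE -rmorphM.
Qed.

Lemma normc_real r : `|r%:C| = `|r|%:C.
Proof. by rewrite normc_def /= expr0n addr0 sqrtr_sqr. Qed.

Lemma rnormZr r v : rnorm (r%:C *: v) = `|r| * rnorm v.
Proof. by rewrite rnormZ normc_real. Qed.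

Lemma rnormZi v : rnorm ('i%C *: v) = rnorm v.
Proof. by rewrite rnormZ normc_def /= expr0n add0r expr1n sqrtr1 mul1r. Qed.

Lemma closureP C v :
  closure C v <-> forall e : R, 0 < e -> exists2 w, C w & rnorm (v - w) < e.
Proof.
split=> [clCv e e0|Cv U].
  have eC : 0 < e%:C by rewrite ltcR.
  have [w [Cw]] := clCv _ (nbhsx_ballx v _ eC).
  by rewrite -ball_normE /= rnormE ltcR => vw; exists w.
rewrite nbhs_ballP => -[e /= e0 eU].
have eE : e = (complex.Re e)%:C by rewrite RRe_real // gtr0_real.
have [|w Cw vw] := Cv (complex.Re e); first by rewrite -ltcR -eE.
exists w; split=> //; apply: eU; rewrite -ball_normE /=.
by rewrite rnormE eE ltcR.
Qed.

Lemma closedP C : closed C <->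
  forall v, (forall e : R, 0 < e -> exists2 w, C w & rnorm (v - w) < e) -> C v.
Proof.
split=> [clC v /closureP|clC v /closureP]; [exact: clC|exact: clC].
Qed.

Lemma closed_norm_le r : closed [set v : V | rnorm v <= r].
Proof.
apply/closedP => v Cv /=; apply/ler_addgt0Pr => e e0.
have [w wr vw] := Cv _ e0.
rewrite -(subrK w v) addrC.
apply: le_trans (ler_rnormD _ _) _; exact: lerD wr (ltW vw).
Qed.

End RealNorm.

(** The difference [f - g] is additive and bounded, so its zero set is closed. The constant
    [2 * |K| + 1] of the proof is positive whatever the sign of [K]. *)
Lemma closed_equalizer {R : realType} {V W : normedModType R[i]}
    (f g : V -> W) (K : R) :
  {morph f : u v / u - v} -> {morph g : u v / u - v} ->
  (forall v, rnorm (f v) <= K * rnorm v) ->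
  (forall v, rnorm (g v) <= K * rnorm v) ->
  closed [set v | f v = g v].
Proof.
move=> fB gB fK gK; apply/closedP => v Cv /=; apply: subr0_eq.
apply: rnorm_eq0; apply/eqP; rewrite eq_le rnorm_ge0 andbT.
apply/ler_addgt0Pr => e e0; rewrite add0r.
have K1 : 0 < 2 * `|K| + 1 by have := normr_ge0 K; lra.
have [w fgw vw] := Cv _ (divr_gt0 e0 K1).
have -> : f v - g v = f (v - w) - g (v - w).
  by rewrite fB gB fgw opprB addrA subrK.
apply: le_trans (ler_rnormD _ _) _; rewrite rnormN.
apply: (@le_trans _ _ ((2 * `|K| + 1) * rnorm (v - w))); last first.
  by rewrite mulrC -ler_pdivlMr // ltW.
have : K * rnorm (v - w) <= `|K| * rnorm (v - w).
  by rewrite ler_wpM2r ?rnorm_ge0 // ler_norm.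
have := fK (v - w); have := gK (v - w); have := rnorm_ge0 (v - w); lra.
Qed.

(** Telescoping bounds the increments of [u] by those of the monotone bounded sequence [r], so [u]
    is Cauchy. *)
Lemma cauchy_seq_limit {R : realType} {V : completeNormedModType R[i]}
    (u : nat -> V) (r : nat -> R) : nondecreasing_seq r ->
  has_ubound (range r) ->
  (forall n, rnorm (u n.+1 - u n) <= r n.+1 - r n) ->
  exists l, forall e : R, 0 < e -> exists N, forall n, (N <= n)%N ->
    rnorm (l - u n) < e.
Proof.
move=> r_nd r_ub u_r.
have ur n k : rnorm (u (n + k)%N - u n) <= r (n + k)%N - r n.
  elim: k => [|k IHk]; first by rewrite addn0 !subrr rnorm0.
  rewrite addnS -(subrK (u (n + k)%N) (u (n + k).+1)) -addrA.
  apply: le_trans (ler_rnormD _ _) _; move: IHk (u_r (n + k)%N); lra.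
have r_cvg := nondecreasing_is_cvgn r_nd r_ub.
have r_lim : forall e : R, 0 < e -> exists N, forall n, (N <= n)%N ->
    rnorm (u n - u N) < e.
  move=> e e0.
  have [N _ rN] := (@cvgrPdist_lt _ _ _ _ _ r (limn r)).1 r_cvg _ e0.
  exists N => n Nn; rewrite -(subnKC Nn); apply: le_lt_trans (ur _ _) _.
  have := rN N (leqnn N); rewrite /= ltr_norml => /andP[_].
  have := nondecreasing_cvgn_le r_nd r_cvg (N + (n - N))%N; lra.
have u_cvg : cvgn u.
  apply/cauchy_cvgP/cauchy_exP => e e0.
  have eE : e = (complex.Re e)%:C by rewrite RRe_real // gtr0_real.
  have [|N uN] := r_lim (complex.Re e); first by rewrite -ltcR -eE.
  exists (u N); exists N => // n /= Nn.
  by rewrite -ball_normE /= rnormE eE ltcR rnorm_distC uN.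
exists (limn u) => e e0.
have eC : 0 < e%:C by rewrite ltcR.
have [N _ uN] := (@cvgrPdist_lt _ _ _ _ _ u (limn u)).1 u_cvg _ eC.
by exists N => n Nn; have := uN n Nn; rewrite /= rnormE ltcR.
Qed.

Local Notation "a ** b" := (cmul a b) (at level 40, left associativity).

(** * Algebra with the involution, and the fixed point behind square roots *)

Section StarAlgebra.
Context {R : realType} {A : unitalCstarAlgType R}.
Implicit Types (a b c h k x : A) (B : set A) (r s t : R).

Lemma cmul0l a : 0 ** a = 0.
Proof. by rewrite -(scale0r 0) cmulZl !scale0r. Qed.

Lemma cmul0r a : a ** 0 = 0.
Proof. by rewrite -(scale0r 0) cmulZr !scale0r. Qed.

Lemma cmulNl a b : (- a) ** b = - (a ** b).
Proof. by rewrite -scaleN1r cmulZl scaleN1r. Qed.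

Lemma cmulNr a b : a ** (- b) = - (a ** b).
Proof. by rewrite -scaleN1r cmulZr scaleN1r. Qed.

Lemma cmulBl a b c : (a - b) ** c = a ** c - b ** c.
Proof. by rewrite cmulDl cmulNl. Qed.

Lemma cmulBr a b c : c ** (a - b) = c ** a - c ** b.
Proof. by rewrite cmulDr cmulNr. Qed.

Lemma star0 : star 0 = 0 :> A.
Proof. by apply: (addrI (star 0)); rewrite -starD !addr0. Qed.

Lemma starN a : star (- a) = - star a.
Proof. by apply/eqP; rewrite -addr_eq0 -starD addNr star0. Qed.

Lemma starB a b : star (a - b) = star a - star b.
Proof. by rewrite starD starN. Qed.

Lemma starZr r a : star (r%:C *: a) = r%:C *: star a.
Proof. by rewrite starZ; congr (_ *: _); rewrite /= oppr0. Qed.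

Lemma starZi a : star ('i%C *: a) = - ('i%C *: star a).
Proof. by rewrite starZ -scaleNr; congr (_ *: _); simpc. Qed.

Lemma star1 : star cone = cone :> A.
Proof. by rewrite -[LHS]cmul1l -{1}(starK cone) -starM cmul1l starK. Qed.

Lemma star_mul_self a : star (star a ** a) = star a ** a.
Proof. by rewrite starM starK. Qed.

Lemma rnormM a b : rnorm (a ** b) <= rnorm a * rnorm b.
Proof. by rewrite -lecR rmorphM /= -!rnormE norm_cmul. Qed.

Lemma rnorm_starM a : rnorm (star a ** a) = rnorm a ^+ 2.
Proof.
by have := norm_starM a; rewrite !rnormE -rmorphXn => /(congr1 (@complex.Re _)).
Qed.

Lemma rnorm_sqr a : star a = a -> rnorm (a ** a) = rnorm a ^+ 2.
Proof. by move=> aE; rewrite -rnorm_starM aE. Qed.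

(** Divide [|a|^2 = |star a ** a| <= |star a| |a|] by [|a|]. *)
Lemma ler_rnorm_star a : rnorm a <= rnorm (star a).
Proof.
have := rnormM (star a) a; rewrite rnorm_starM expr2 => a2.
have [a0|a0] := eqVneq (rnorm a) 0; first by rewrite a0 rnorm_ge0.
by rewrite -(ler_pM2r (_ : 0 < rnorm a)) // lt_def a0 rnorm_ge0.
Qed.

Lemma rnorm_star a : rnorm (star a) = rnorm a.
Proof.
by apply/eqP; rewrite eq_le ler_rnorm_star andbT -{2}(starK a) ler_rnorm_star.
Qed.

(** The norm [n] of the unit satisfies [n = n^2]; the zero algebra is allowed, hence an
    inequality. *)
Lemma rnorm1 : rnorm (cone : A) <= 1.
Proof.
have := rnorm_starM (cone : A); rewrite star1 cmul1r => n1.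
have [->//|n0] := eqVneq (rnorm (cone : A)) 0.
by rewrite -(mulfI n0 (etrans (mulr1 _) n1)).
Qed.

Lemma sqr_eq0 a : star a = a -> a ** a = 0 -> a = 0.
Proof.
move=> aE aa0; apply/rnorm_eq0/eqP.
by rewrite -sqrf_eq0 -rnorm_sqr // aa0 rnorm0.
Qed.

(** The fourth power of [a] vanishes, and [sqr_eq0] applies twice, to [a ** a] and then to [a]. *)
Lemma cube_eq0 a : star a = a -> a ** a ** a = 0 -> a = 0.
Proof.
move=> aE a3; apply/sqr_eq0 => //; apply/sqr_eq0; first by rewrite starM aE.
by rewrite cmulA a3 cmul0l.
Qed.

(** Stability under [star] is left out so that the commutant of an arbitrary element qualifies. *)
Definition closed_subalgebra B :=
  [/\ linear_subspace B, closed B, B cone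
    & forall a b, B a -> B b -> B (a ** b)].

Lemma subspaceZ B (z : R[i]) a : linear_subspace B -> B a -> B (z *: a).
Proof. by move=> [B0 BD] Ba; rewrite -[_ *: _]addr0; exact: BD. Qed.

Lemma subspaceD B a b : linear_subspace B -> B a -> B b -> B (a + b).
Proof. by move=> [B0 BD] Ba Bb; rewrite -[a]scale1r; exact: BD. Qed.

Lemma subspaceB B a b : linear_subspace B -> B a -> B b -> B (a - b).
Proof.
move=> sB Ba Bb; apply: subspaceD => //.
by rewrite -scaleN1r; exact: subspaceZ.
Qed.

Lemma commutant_closed_subalgebra a :
  closed_subalgebra [set b | a ** b = b ** a].
Proof.
split=> /=.
- split=> [|c u v /= au av] /=; first by rewrite cmul0l cmul0r.
  by rewrite cmulDl cmulDr cmulZl cmulZr au av.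
- apply: (@closed_equalizer R A A _ _ (rnorm a)) => [u v|u v|v|v].
  + exact: cmulBr.
  + exact: cmulBl.
  + exact: rnormM.
  + by rewrite mulrC rnormM.
- by rewrite cmul1l cmul1r.
- by move=> b c ab ac; rewrite cmulA ab -cmulA ac cmulA.
Qed.

Lemma selfadjoint_closed : closed [set a : A | star a = a].
Proof.
apply: (@closed_equalizer R A A _ id 1) => // [u v|v|v].
- exact: starB.
- by rewrite mul1r rnorm_star.
- by rewrite mul1r.
Qed.

(* The iteration below is dominated by the scalar one with y = 1, whence its
   convergence; [1 - w] is the square root of [1 - y] given by the binomial
   series. *)
Lemma sqrt_fixpoint (y : A) : rnorm y <= 1 ->
  exists w, [/\ rnorm w <= 1, w + w = y + w ** w
    & forall C : set A, closed C -> C 0 ->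
        (forall v, C v -> C ((2^-1)%:C *: (y + v ** v))) -> C w].
Proof.
move=> y1.
pose f v := (2^-1)%:C *: (y + v ** v); pose w n := iter n f 0.
pose g (s : R) := (1 + s ^+ 2) / 2; pose r n := iter n g 0.
have r01 n : 0 <= r n <= 1.
  elim: n => [|n]; first by rewrite /r /= lexx ler01.
  rewrite /r /= /g -/(r n) => /andP[r0 r1].
  have := sqr_ge0 (r n); have := exprn_ile1 2 r0 r1; lra.
have r_le n : r n <= r n.+1.
  elim: n => [|n]; first by have /andP[] := r01 1.
  have /andP[r0 _] := r01 n; have /andP[r1 _] := r01 n.+1 => rn.
  have : r n ^+ 2 <= r n.+1 ^+ 2 by rewrite lerXn2r.
  rewrite -/(g (r n.+1)); have -> : r n.+2 = g (r n.+1) by [].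
  have -> : r n.+1 = g (r n) by []; rewrite /g; lra.
have rS n : r n.+1 = (1 + r n ^+ 2) / 2 by [].
have wS n : w n.+1 = (2^-1)%:C *: (y + w n ** w n) by [].
have half_ge0 : `|2^-1 : R| = 2^-1 by rewrite ger0_norm // invr_ge0.
have wr n : rnorm (w n) <= r n.
  elim: n => [|n IHn]; first by rewrite rnorm0.
  rewrite wS rS rnormZr half_ge0.
  have : rnorm (w n) * rnorm (w n) <= r n * r n by rewrite ler_pM ?rnorm_ge0.
  have := ler_rnormD y (w n ** w n); have := rnormM (w n) (w n).
  rewrite expr2; lra.
(* The identity [u^2 - v^2 = u (u - v) + (u - v) v] holds without commutativity. *)
have f_lip u v :
    rnorm (f u - f v) <= 2^-1 * (rnorm u + rnorm v) * rnorm (u - v).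
  have -> : f u - f v = (2^-1)%:C *: (u ** (u - v) + (u - v) ** v).
    rewrite -scalerBr cmulBr cmulBl; congr (_ *: _).
    by rewrite opprD addrACA subrr add0r addrA subrK.
  rewrite rnormZr half_ge0 -mulrA ler_wpM2l ?invr_ge0 //.
  apply: le_trans (ler_rnormD _ _) _.
  by rewrite mulrDl lerD ?rnormM // mulrC rnormM.
have w_r n : rnorm (w n.+1 - w n) <= r n.+1 - r n.
  elim: n => [|n IHn].
    rewrite [w 0%N]/= [r 0%N]/= !subr0 wS rS rnormZr half_ge0 /= cmul0l addr0.
    by rewrite expr0n addr0; lra.
  apply: le_trans (f_lip _ _) _.
  have : (rnorm (w n.+1) + rnorm (w n)) * rnorm (w n.+1 - w n)
      <= (r n.+1 + r n) * (r n.+1 - r n).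
    by rewrite ler_pM ?addr_ge0 ?rnorm_ge0 ?lerD.
  rewrite [r n.+2]rS [X in _ <= _ - X]rS -mulrA; lra.
have [||l wl] := @cauchy_seq_limit _ A w r _ _ w_r.
- by apply/nondecreasing_seqP.
- by exists 1 => _ [n _ <-]; have /andP[] := r01 n.
have wC C : closed C -> C 0 -> (forall v, C v -> C (f v)) -> C l.
  move=> /closedP clC C0 fC; apply: clC => e /wl[N wN].
  exists (w N); last exact: wN.
  by elim: N {wN} => // n; exact: fC.
have l1 : rnorm l <= 1.
  apply: ((closedP _).1 (@closed_norm_le _ A 1)) => e /wl[N wN].
  exists (w N); last exact: wN.
  by apply: le_trans (wr N) _; have /andP[] := r01 N.
exists l; split => //.
(* Both [w n] and [l] have norm at most 1, so [f_lip] has constant 1 between them; this suffices to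
   pass to the limit in [w n.+1 = f (w n)]. *)
have : rnorm (l - f l) <= 0.
  apply/ler_addgt0Pr => e e0; have [N wN] := wl _ (divr_gt0 e0 (ltr0n _ 2)).
  have -> : l - f l = (l - w N.+1) + (f (w N) - f l).
    by rewrite addrA subrK.
  apply: le_trans (ler_rnormD _ _) _.
  have := f_lip (w N) l; have := wN N (leqnn N); have := wN N.+1 (leqnSn N).
  rewrite [rnorm (w N - l)]rnorm_distC.
  have : (rnorm (w N) + rnorm l) * rnorm (l - w N) <= 2 * rnorm (l - w N).
    rewrite ler_wpM2r ?rnorm_ge0 //.
    by have := wr N; have /andP[_] := r01 N; lra.
  rewrite -mulrA; lra.
move=> l0; have /subr0_eq lE : l - f l = 0.
  by apply: rnorm_eq0; apply/eqP; rewrite eq_le l0 rnorm_ge0.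
have two : (2^-1)%:C * 2 = 1 :> R[i].
  by rewrite -(rmorph_nat (real_complex R) 2) -rmorphM mulVf ?pnatr_eq0.
have -> : l + l = 2 *: l by rewrite scaler_nat.
by rewrite {1}lE /f scalerA mulrC two scale1r.
Qed.

End StarAlgebra.

(** * The cone of positive elements and their square roots *)

Section Positivity.
Context {R : realType} {A : unitalCstarAlgType R}.
Implicit Types (a b c d h k x : A) (B : set A) (r s t : R).

Lemma scalerrD r s a : (r + s)%:C *: a = r%:C *: a + s%:C *: a.
Proof. by rewrite rmorphD scalerDl. Qed.

Lemma scalerrM r s a : (r * s)%:C *: a = r%:C *: (s%:C *: a).
Proof. by rewrite rmorphM scalerA. Qed.

Lemma scalerrVK r a : r != 0 -> r%:C *: (r^-1%:C *: a) = a.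
Proof. by move=> r0; rewrite -scalerrM mulfV // scale1r. Qed.

(* For a self-adjoint [h], [`|t - h| <= t] says that the spectrum of [h] lies
   in [[0, 2t]]; with this definition the positive elements form a cone without
   any spectral theory. *)
Definition is_pos h :=
  star h = h /\ exists t : R, rnorm (t%:C *: cone - h) <= t.

Lemma is_pos0 : is_pos 0.
Proof.
by split; [exact: star0|exists 0; rewrite scale0r subr0 rnorm0].
Qed.

Lemma is_posD h k : is_pos h -> is_pos k -> is_pos (h + k).
Proof.
move=> [hh [s hs]] [kk [t kt]]; split; first by rewrite starD hh kk.
exists (s + t); rewrite scalerrD opprD addrACA.
by apply: le_trans (ler_rnormD _ _) _; rewrite lerD.
Qed.

Lemma is_posZ r h : 0 <= r -> is_pos h -> is_pos (r%:C *: h).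
Proof.
move=> r0 [hh [s hs]]; split; first by rewrite starZr hh.
by exists (r * s); rewrite scalerrM -scalerBr rnormZr ger0_norm // ler_wpM2l.
Qed.

Lemma is_pos_sub t h : star h = h -> rnorm h <= t -> is_pos (t%:C *: cone - h).
Proof.
move=> hh ht; split; first by rewrite starB starZr star1 hh.
by exists t; rewrite opprB addrC subrK.
Qed.

Lemma is_pos1 : is_pos cone.
Proof.
split; first exact: star1.
by exists 1; rewrite scale1r subrr rnorm0.
Qed.

(** The element [y = 1 - h / t] has norm at most 1, and [1 - w] is a root of [1 - y = h / t];
    rescaling by [sqrt t] gives [c]. Only limits of polynomials in [h] occur, so [c] stays in every
    closed subalgebra containing [h]. *)
Lemma is_pos_sqrt h : is_pos h -> exists c, [/\ is_pos c, c ** c = h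
  & forall B, closed_subalgebra B -> B h -> B c].
Proof.
move=> [hh [t ht]].
have t0 : 0 <= t := le_trans (rnorm_ge0 _) ht.
have [tE|tN0] := eqVneq t 0.
  have h0 : h = 0.
    apply: rnorm_eq0; apply/eqP; rewrite eq_le rnorm_ge0 andbT.
    by move: ht; rewrite tE scale0r add0r rnormN.
  exists 0; split=> [|| B [[B0 _] _ _ _] _ //]; first exact: is_pos0.
  by rewrite cmul0l h0.
pose y : A := cone - t^-1%:C *: h.
have y1 : rnorm y <= 1.
  have -> : y = t^-1%:C *: (t%:C *: cone - h).
    by rewrite scalerBr -scalerrM mulVf // scale1r.
  rewrite rnormZr ger0_norm ?invr_ge0 // ler_pdivrMl ?mulr1 //.
  by rewrite lt_def tN0.
have [w [w1 wE wC]] := sqrt_fixpoint y1.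
have yy : star y = y by rewrite starB star1 starZr hh.
have ww : star w = w.
  apply: (wC [set v | star v = v]) => /=; first exact: selfadjoint_closed.
    exact: star0.
  by move=> v vv; rewrite starZr starD starM yy vv.
exists ((Num.sqrt t)%:C *: (cone - w)); split.
- split; first by rewrite starZr starB star1 ww.
  exists (Num.sqrt t); rewrite -scalerBr opprB addrC subrK rnormZr.
  by rewrite ger0_norm ?sqrtr_ge0 // ler_piMr ?sqrtr_ge0.
- rewrite cmulZl cmulZr -scalerrM -expr2 sqr_sqrtr //.
  have -> : (cone - w) ** (cone - w) = t^-1%:C *: h; last exact: scalerrVK.
  rewrite cmulBl !cmulBr !cmul1r cmul1l -addrA -opprD addrA wE addrK.
  by rewrite opprB addrC subrK.
- move=> B [sB clB B1 BM] Bh; apply: subspaceZ => //; apply: subspaceB => //.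
  apply: wC => //; first by case: sB.
  move=> v Bv; apply: subspaceZ => //; apply: subspaceD => //; last exact: BM.
  by apply: subspaceB => //; exact: subspaceZ.
Qed.

(** The commutant of [a] is a closed subalgebra containing [h], hence the root. *)
Lemma is_pos_sqrt_commute h a : is_pos h -> a ** h = h ** a ->
  exists c, [/\ is_pos c, c ** c = h & a ** c = c ** a].
Proof.
move=> /is_pos_sqrt[c [cp ch cC]] ah; exists c; split => //.
exact: cC (commutant_closed_subalgebra a) ah.
Qed.

(* [c] is the real part of the unitary [c + i sqrt (1 - c^2)], whose imaginary
   part is a contraction as well. *)
Lemma contraction_sqr c : star c = c -> rnorm c <= 1 ->
  rnorm (cone - c ** c) <= 1.
Proof.
move=> cc c1.
have cc1 : rnorm (c ** c) <= 1.
  by rewrite rnorm_sqr // exprn_ile1 ?rnorm_ge0.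
have pos1c : is_pos (cone - c ** c).
  rewrite -[cone]scale1r -[1]/(1%:C); apply: is_pos_sub => //.
  by rewrite starM cc.
have [|d [[dd _] d2 cd]] := @is_pos_sqrt_commute _ c pos1c.
  by rewrite cmulBl cmulBr cmul1l cmul1r cmulA.
pose u : A := c + 'i%C *: d.
have us : star u = c - 'i%C *: d by rewrite starD cc starZi dd.
have u1 : rnorm u <= 1.
  have : rnorm u ^+ 2 <= 1.
    rewrite -rnorm_starM us cmulBl !cmulDr !cmulZl !cmulZr scalerA cd.
    have -> : ('i%C * 'i%C = -1 :> R[i]) by simpc.
    rewrite scaleN1r opprB addrACA subrr addr0 d2 addrC.
    by rewrite subrK rnorm1.
  by rewrite expr_le1 // rnorm_ge0.
(* This difference is [2 i d], so the bound makes [d] a contraction. *)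
have : rnorm (u - star u) <= 2.
  apply: le_trans (ler_rnormD _ _) _.
  by rewrite rnormN rnorm_star; move: u1; lra.
rewrite us opprB addrCA [c + _ + _]addrC addKr -scalerDr rnormZi => d2n.
have d1 : rnorm d <= 1.
  move: d2n; have -> : d + d = 2%:C *: d.
    by rewrite -mulr2n -scaler_nat (rmorph_nat (real_complex R) 2).
  by rewrite rnormZr ger0_norm //; lra.
by rewrite -d2 rnorm_sqr // exprn_ile1 ?rnorm_ge0.
Qed.

(** Rescaling reduces to a contraction, for which radius 1 works by [contraction_sqr]. The added 1
    in [r] keeps it positive when [c = 0]. *)
Lemma is_pos_sqr c : star c = c -> is_pos (c ** c).
Proof.
move=> cc; pose r := rnorm c + 1.
have r0 : 0 < r by rewrite ltr_wpDl ?rnorm_ge0.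
have rN0 : r != 0 by rewrite gt_eqF.
pose d := r^-1%:C *: c.
have dd : star d = d by rewrite starZr cc.
have -> : c ** c = (r ^+ 2)%:C *: (d ** d).
  by rewrite cmulZl cmulZr -!scalerrM expr2 mulfK // mulfV // scale1r.
apply: is_posZ; first exact: sqr_ge0.
split; first by rewrite starM dd.
exists 1; rewrite scale1r; apply: contraction_sqr => //.
rewrite rnormZr ger0_norm ?invr_ge0 ?(ltW r0) // ler_pdivrMl // mulr1 /r lerDl.
exact: ler01.
Qed.

(** Here [h / t] is the square of a contraction, so [contraction_sqr] applies. The radius in
    [is_pos] can thus be chosen uniformly in [h], as limits require. *)
Lemma is_pos_rnorm h t : is_pos h -> rnorm h <= t ->
  rnorm (t%:C *: cone - h) <= t.
Proof.
move=> hp ht; have t0 : 0 <= t := le_trans (rnorm_ge0 _) ht.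
have [tE|tN0] := eqVneq t 0.
  by move: ht; rewrite tE scale0r add0r rnormN.
have tp : 0 < t by rewrite lt_def tN0.
have ti : 0 <= t^-1 by rewrite invr_ge0.
have [c [[cc _] ch _]] := is_pos_sqrt (is_posZ ti hp).
have -> : t%:C *: cone - h = t%:C *: (cone - c ** c).
  by rewrite ch scalerBr scalerrVK.
rewrite rnormZr ger0_norm // ler_piMr // contraction_sqr //.
have : rnorm c ^+ 2 <= 1.
  by rewrite -rnorm_sqr // ch rnormZr ger0_norm // ler_pdivrMl // mulr1.
by rewrite expr_le1 // rnorm_ge0.
Qed.

(** With [t = |h|], both [t - h] and [t + h] have norm at most [t]. Since
    [(t + h)^2 - (t - h)^2 = 4 t h], this gives [4 t^2 <= 2 t^2]. *)
Lemma is_pos_anti h : is_pos h -> is_pos (- h) -> h = 0.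
Proof.
move=> hp hn; pose t := rnorm h.
have /= h1 := is_pos_rnorm hp (lexx t).
have := is_pos_rnorm hn (_ : _ <= t); rewrite rnormN lexx opprK => /(_ isT) h2.
have t0 : 0 <= t := rnorm_ge0 h.
set u := t%:C *: cone - h in h1; set v := t%:C *: cone + h in h2.
have : rnorm (v ** v - u ** u) <= 2 * t ^+ 2.
  apply: le_trans (ler_rnormD _ _) _; rewrite rnormN.
  have := rnormM u u; have := rnormM v v.
  have : rnorm u * rnorm u <= t * t by rewrite ler_pM ?rnorm_ge0.
  have : rnorm v * rnorm v <= t * t by rewrite ler_pM ?rnorm_ge0.
  rewrite expr2; lra.
have -> : v ** v - u ** u = (4 * t)%:C *: h.
  rewrite /u /v cmulBl !cmulBr cmulDl !cmulDr !cmulZl !cmulZr cmul1l cmul1r.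
  rewrite cmul1l; set x := _ *: (_ *: _); set y := t%:C *: h; set z := h ** h.
  have -> : x + y + (y + z) - (x - y - (y - z)) = y + y + (y + y).
    rewrite [x + y + _](AC (2*2) ((1*4)*(2*3))) /= (opprB y z).
    rewrite [x - y + _]addrACA -opprD opprB [x + z + _]addrC.
    by rewrite addrACA subrr addr0.
  rewrite -!mulr2n -mulrnA scalerrM (rmorph_nat (real_complex R) 4).
  by rewrite scaler_nat.
rewrite rnormZr ger0_norm ?mulr_ge0 // -/t => tt.
apply: rnorm_eq0; apply/eqP; rewrite -sqrf_eq0 eq_le sqr_ge0 andbT -/t.
by move: tt; rewrite expr2; lra.
Qed.

(** By [is_pos_rnorm] the single radius [|h| + 1] serves all [e + h] with [e <= 1], so the norm
    bound passes to the limit. *)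
Lemma is_pos_limit h : (forall e : R, 0 < e -> is_pos (e%:C *: cone + h)) ->
  is_pos h.
Proof.
move=> he; have hh : star h = h.
  have [] := he 1 ltr01; rewrite starD starZr star1 => /addrI hh _; exact: hh.
split=> //; pose t := rnorm h + 1; exists t; apply/ler_addgt0Pr => e e0.
pose f := Num.min e 1.
have f0 : 0 < f by rewrite lt_min e0 ltr01.
have fe : f <= e by rewrite ge_min lexx.
have f1 : f <= 1 by rewrite ge_min lexx orbT.
have fn : rnorm (f%:C *: cone : A) <= f.
  by rewrite rnormZr gtr0_norm // ler_piMr ?rnorm1 // ltW.
have -> : t%:C *: cone - h = t%:C *: cone - (f%:C *: cone + h) + f%:C *: cone.
  by rewrite opprD addrA addrAC subrK.
apply: le_trans (ler_rnormD _ _) _; apply: lerD; last exact: le_trans fn fe.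
apply: is_pos_rnorm; first exact: he.
by apply: le_trans (ler_rnormD _ _) _; rewrite /t; lra.
Qed.

End Positivity.

(** * Positivity of [star x ** x] and uniqueness of positive square roots *)

Section StarSquares.
Context {R : realType} {A : unitalCstarAlgType R}.
Implicit Types (a b c d g h k x : A) (B : set A).

(** Up to sign, [u] and [v] are twice the real and imaginary parts of [x], and the sum is half of
    [u^2 + v^2]. *)
Lemma is_pos_star_sum x : is_pos (star x ** x + x ** star x).
Proof.
pose u := x + star x; pose v : A := 'i%C *: (x - star x).
have uu : star u = u by rewrite starD starK addrC.
have vv : star v = v by rewrite starZi starB starK -scalerN opprB.
have -> : star x ** x + x ** star x = (2^-1)%:C *: (u ** u + v ** v).
  have -> : u ** u + v ** v
      = 2%:C *: (star x ** x + x ** star x).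
    rewrite cmulZl cmulZr scalerA (_ : 'i%C * 'i%C = -1); last by simpc.
    rewrite scaleN1r cmulBl !cmulBr cmulDl !cmulDr.
    move: (x ** x) (x ** star x) (star x ** x) (star x ** star x) => p q r t.
    rewrite !opprB [LHS](AC ((2*2)*(2*2)) (((1*8)*(4*6))*((3*2)*(5*7)))) /=.
    by rewrite !subrr !add0r (rmorph_nat (real_complex R) 2) scaler_nat.
  by rewrite -scalerrM mulVf ?pnatr_eq0 // scale1r.
by apply: is_posZ; [rewrite invr_ge0|apply: is_posD; exact: is_pos_sqr].
Qed.

(** With [s] the root of [k], [w = x s] and [l = x ** star x], one has [star w ** w = - k^2] and
    [w ** star w = - l^2]. Thus [- k^2 = (star w ** w + w ** star w) + l^2] is positive, which
    forces [k^2 = 0]; no comparison of spectra is involved. *)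
Lemma star_mul_neg_eq0 x k : is_pos k -> star x ** x = - k -> k = 0.
Proof.
move=> kp xk; have [s [[ss _] sk _]] := is_pos_sqrt kp.
have kk : star k = k by case: kp.
pose w := x ** s; pose l := x ** star x.
have wsw : star w ** w = - (k ** k).
  by rewrite starM ss cmulA -[s ** _ ** x]cmulA xk cmulNr cmulNl -sk !cmulA.
have wws : w ** star w = - (l ** l).
  rewrite starM ss cmulA -[x ** s ** s]cmulA sk -[k]opprK -xk.
  by rewrite cmulNr cmulNl !cmulA.
have kN : is_pos (- (k ** k)).
  rewrite -wsw -[star w ** w](addrK (w ** star w)) {2}wws opprK.
  apply: is_posD; first exact: is_pos_star_sum.
  by apply: is_pos_sqr; rewrite starM starK.
by apply: sqr_eq0 => //; apply: is_pos_anti => //; exact: is_pos_sqr.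
Qed.

(* Kaplansky: with [m = |h|], the element [n = m - h] is twice the negative part
   of [h = c^* c], and [(c n)^* (c n) = n h n = - n m n] is negative. *)
Lemma is_pos_star_mul c : is_pos (star c ** c).
Proof.
have := star_mul_self c; move hE : (star c ** c) => h hh.
have [m [mp m2 hm]] := is_pos_sqrt_commute (is_pos_sqr hh) (cmulA h h h).
have [mm _] := mp; pose n := m - h.
have nn : star n = n by rewrite starB mm hh.
have nm : n ** m = m ** n by rewrite cmulBl cmulBr hm.
have [s [[ss _] s2 ns]] := is_pos_sqrt_commute mp nm.
have nmn : n ** m ** n = (s ** n) ** (s ** n).
  by rewrite -s2 !cmulA ns.
have nmn_pos : is_pos (n ** m ** n).
  by rewrite nmn; apply: is_pos_sqr; rewrite starM ss nn ns.
have hn : h ** n = - (m ** n) by rewrite !cmulBr opprB hm m2.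
have nhn : n ** h ** n = - (n ** m ** n) by rewrite -!cmulA hn cmulNr.
have n0 : n ** m ** n = 0.
  apply: (star_mul_neg_eq0 (x := c ** n) nmn_pos).
  by rewrite -nhn starM nn -hE !cmulA.
have /subr0_eq <- // : m - h = 0.
(* The cube of [n] is [n m n - n h n], and both terms vanish. *)
apply: cube_eq0 => //; rewrite -/n {2}/n cmulBr cmulBl nhn n0.
by rewrite oppr0 subr0.
Qed.

Lemma cstar_posP h : cstar_pos h <-> is_pos h.
Proof.
split=> [[c ->]|/is_pos_sqrt[c [[cc _] ch _]]]; first exact: is_pos_star_mul.
by exists c; rewrite cc ch.
Qed.

Lemma is_pos_conj x h : is_pos h -> is_pos (star x ** h ** x).
Proof.
move=> /is_pos_sqrt[s [[ss _] <- _]].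
have -> : star x ** (s ** s) ** x = star (s ** x) ** (s ** x).
  by rewrite starM ss !cmulA.
exact: is_pos_star_mul.
Qed.

(** Both are compared with the constructed root [r], which commutes with whatever commutes with
    [d ** d]. For such a root [c] and [e = c - r], [e (c + r) = 0] makes the positive elements
    [e c e] and [e r e] opposite, hence zero, and [e^3] is their difference. *)
Lemma is_pos_sqrt_unique b d : is_pos b -> is_pos d -> b ** b = d ** d -> b = d.
Proof.
move=> bp dp bd; have dd : star d = d by case: dp.
have [r [rp rd rC]] := is_pos_sqrt (is_pos_sqr dd).
suff H c : is_pos c -> c ** c = d ** d -> c = r by rewrite (H b) // (H d).
move=> cp cd.
have cr : c ** r = r ** c.
  by apply: rC (commutant_closed_subalgebra c) _ => /=; rewrite -cd cmulA.
have [cc _] := cp; have [rr _] := rp.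
pose e := c - r; have ee : star e = e by rewrite starB cc rr.
have ecr : e ** (c + r) = 0.
  by rewrite cmulBl !cmulDr cd rd cr [r ** c + _]addrC subrr.
have sum0 : e ** c ** e + e ** r ** e = 0.
  by rewrite -cmulDl -cmulDr ecr cmul0l.
have ecp : is_pos (e ** c ** e) by rewrite -{1}ee; exact: is_pos_conj.
have erp : is_pos (e ** r ** e) by rewrite -{1}ee; exact: is_pos_conj.
have ec0 : e ** c ** e = 0.
  by apply: is_pos_anti => //; rewrite -[- _]addr0 -sum0 addKr.
have er0 : e ** r ** e = 0 by rewrite -sum0 ec0 add0r.
apply: subr0_eq; apply: cube_eq0 => //.
by rewrite -/e {2}/e cmulBr cmulBl ec0 er0 subrr.
Qed.

Lemma cstar_sqrt_sqr h : is_pos h -> cstar_sqrt (h ** h) = h.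
Proof.
move=> hp; apply: xget_unique; first by split=> //; exact/cstar_posP.
move=> b [/cstar_posP bp bh]; exact: is_pos_sqrt_unique.
Qed.

Lemma cstar_sqrtP g : is_pos g -> [/\ is_pos (cstar_sqrt g),
  cstar_sqrt g ** cstar_sqrt g = g
  & forall B, closed_subalgebra B -> B g -> B (cstar_sqrt g)].
Proof. by move=> /is_pos_sqrt[c [cp <- cB]]; rewrite cstar_sqrt_sqr. Qed.

End StarSquares.

(** * M. Riesz's extension theorem for real vector spaces *)

Section RieszExtension.
Context {R : realType} {V : lmodType R}.
Variable P : set V.
Implicit Types (G H : set (V * R^o)) (u v : V) (r t : R).
Hypothesis PD : forall u v, P u -> P v -> P (u + v).
Hypothesis PZ : forall r v, 0 <= r -> P v -> P (r *: v).

(** Partial functionals are kept as graphs, ordered by inclusion for Zorn's lemma. When [P 0] holds,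
    positivity yields single-valuedness: the difference of two pairs over the same point has first
    component 0. *)
Definition positive_graph H :=
  [/\ H 0, forall t p q, H p -> H q -> H (t *: p + q)
    & forall p, H p -> P p.1 -> 0 <= p.2].

Lemma positive_graphN H p : positive_graph H -> H p -> H (- p).
Proof. by move=> [H0 HL _] Hp; rewrite -[- p]addr0 -scaleN1r; exact: HL. Qed.

(** The value at [v] must lie above [p.2] whenever [v - p.1] is in [P], and below [q.2] whenever
    [q.1 - v] is. The supremum of the former values does both. *)
Lemma positive_graph_extend H v : positive_graph H ->
  (forall u, exists2 p, H p & P (p.1 - u)) ->
  exists a : R^o, positive_graph
    [set q | exists2 t : R, H (q - t *: (v, a)) & True].
Proof.
move=> gH unitH; have [H0 HL HP] := gH.
have HD p q : H p -> H q -> H (p + q).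
  by move=> Hp Hq; rewrite -[p]scale1r; exact: HL.
have HZ t p : H p -> H (t *: p).
  by move=> Hp; rewrite -[_ *: _]addr0; exact: HL.
pose S : set R := [set p.2 | p in H `&` [set p | P (v - p.1)]].
have SU q : H q -> P (q.1 - v) -> ubound S q.2.
  move=> Hq qv _ [p [Hp pv] <-]; rewrite -subr_ge0.
  apply: (HP (q - p)); first exact: HD Hq (positive_graphN gH Hp).
  by have := PD qv pv; rewrite addrA subrK.
have S0 : S !=set0.
  have [p Hp pv] := unitH (- v); exists (- p).2; exists (- p) => //.
  split; first exact: positive_graphN.
  by move: pv => /=; rewrite !opprK addrC.
have SB : has_ubound S.
  by have [p Hp pv] := unitH v; exists p.2; exact: SU.
exists (sup S); split=> /=.
- by exists 0 => //; rewrite scale0r subr0.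
- move=> t p q [s Hp _] [s' Hq _]; exists (t * s + s') => //.
  by rewrite scalerDl -scalerA opprD addrACA -scalerBr; exact: HL.
(* After division by [|t|], [v] lies below [q.1] if [t < 0] and above it if [t > 0]; so [q.2] is an
   upper bound of [S], respectively an element of [S]. *)
- move=> p [t Hp _] Pp; have [t0|t0|t0] := ltgtP t 0.
  + pose q := - t^-1 *: (p - t *: (v, sup S : R^o)).
    have tN : 0 <= - t^-1 by rewrite oppr_ge0 invr_le0 ltW.
    have /ge_sup : ubound S q.2.
      apply: SU; first exact: HZ.
      have -> : q.1 - v = - t^-1 *: p.1.
        rewrite /q /= scalerBr scalerA mulNr mulVf ?lt_eqF // scaleN1r opprK.
        by rewrite addrK.
      exact: PZ.
    move=> /(_ S0); rewrite /q /= -[_ *: (_ - _)]/(_ * (p.2 - t * sup S)).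
    rewrite mulrBr mulrA !mulNr mulVf ?lt_eqF // mul1r opprK lerDr oppr_ge0.
    by rewrite nmulr_rle0 // invr_lt0.
  + pose q := - t^-1 *: (p - t *: (v, sup S : R^o)).
    have ti : 0 < t^-1 by rewrite invr_gt0.
    have /(ub_le_sup SB) : S q.2.
      exists q => //; split; first exact: HZ.
      change (P (v - q.1)).
      have -> : v - q.1 = t^-1 *: p.1.
        rewrite /q /= scalerBr scalerA mulNr mulVf ?gt_eqF // scaleN1r opprK.
        by rewrite opprD addrCA subrr addr0 scaleNr opprK.
      exact: PZ (ltW ti) Pp.
    rewrite /q /= -[_ *: (_ - _)]/(_ * (p.2 - t * sup S)).
    rewrite mulrBr mulrA !mulNr mulVf ?gt_eqF // mul1r opprK gerDr oppr_le0.
    by rewrite pmulr_rge0.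
  + by apply: HP => //; move: Hp; rewrite t0 scale0r subr0.
Qed.

(* M. Riesz's extension theorem, for a functional given by its graph [G]. *)
Lemma riesz_extension G : positive_graph G ->
  (forall v, exists2 p, G p & P (p.1 - v)) ->
  exists f : V -> R, [/\ forall t u v, f (t *: u + v) = t * f u + f v,
    forall v, P v -> 0 <= f v & forall p, G p -> f p.1 = p.2].
Proof.
move=> gG unitG.
pose good H := H = set0 \/ positive_graph H /\ G `<=` H.
have [F goodF totF|H [[H0|[gH GH]] Hmax]] := @Zorn_bigcup _ good.
- have [/existsNP[H /not_implyP[FH HN0]]|F0] :=
    pselect (~ forall H, F H -> H = set0); last first.
    left; apply/seteqP; split=> // p [H FH].
    by move/contrapT: F0 => /(_ _ FH) ->.
  have gF K p : F K -> K p -> positive_graph K.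
    by move=> FK Kp; have [K0|[]//] := goodF _ FK; rewrite K0 in Kp.
  have /set0P[p Hp] : H != set0 by apply/eqP.
  have gH := gF _ _ FH Hp.
  right; split; first split.
  + by exists H => //; case: gH.
  + move=> t q q' [K FK Kq] [K' FK' Kq'].
    have [KK'|K'K] := totF _ _ FK FK'.
      by exists K' => //; have [_ + _] := gF _ _ FK' Kq'; apply=> //; exact: KK'.
    by exists K => //; have [_ + _] := gF _ _ FK Kq; apply=> //; exact: K'K.
  + by move=> q [K FK Kq]; have [_ _ +] := gF _ _ FK Kq; apply.
  + have [K0|[_ GH]] := goodF _ FH; first by rewrite K0 in Hp.
    by move=> q /GH Hq; exists H.
- have [G0 _ _] := gG; exfalso; apply: (Hmax G); last by right; split.
  by rewrite H0; split=> // /(_ 0 G0).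
have unitH v : exists2 p, H p & P (p.1 - v).
  by have [p /GH Hp pv] := unitG v; exists p.
have [Hz HL HP] := gH.
have P0 : P 0.
  by have [p _ pP] := unitG 0; rewrite -(scale0r (p.1 - 0)); exact: PZ.
have Htot v : exists r : R^o, H (v, r).
  (* If [v] were outside the domain of [H], this extension would contradict maximality. *)
  have [a gK] := positive_graph_extend v gH unitH.
  exists a; apply: contrapT => NH.
  apply: (Hmax [set q | exists2 t : R, H (q - t *: (v, a)) & True]).
    split=> [p Hp|]; first by exists 0 => //; rewrite scale0r subr0.
    move=> /(_ (v, a)); apply: contra_not NH; apply.
    by exists 1 => //; rewrite scale1r subrr.
  right; split=> // p /GH Hp.
  by exists 0 => //; rewrite scale0r subr0.
have Huniq p q : H p -> H q -> p.1 = q.1 -> p.2 = q.2.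
  have le p' q' : H p' -> H q' -> p'.1 = q'.1 -> p'.2 <= q'.2.
    move=> Hp Hq pq; rewrite -subr_ge0; apply: (HP (q' - p')).
      by rewrite addrC -scaleN1r; exact: HL.
    by rewrite /= pq subrr.
  by move=> Hp Hq pq; apply/eqP; rewrite eq_le !le.
have [f fP] := choice Htot; exists f; split.
- move=> t u v; apply: (Huniq (_, _) (_, _) (fP _)) => //.
  exact: (HL t _ _ (fP u) (fP v)).
- by move=> v Pv; exact: HP (fP v) Pv.
- by move=> p Gp; apply: (Huniq (_, _) p (fP _)) => //; exact: GH.
Qed.

End RieszExtension.

(** * Restriction of scalars from [R[i]] to [R], on a copy of the type *)

Definition realified {R : realType} (V : lmodType R[i]) : Type := V.

Section Realified.
Context {R : realType} {V : lmodType R[i]}.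
Implicit Types (r s : R) (u v : V).

HB.instance Definition _ := GRing.Zmodule.on (realified V).

Let scale r v : V := r%:C *: v.

Let scaleA r s v : scale r (scale s v) = scale (r * s) v.
Proof. by rewrite /scale rmorphM scalerA. Qed.

Let scale1 : left_id 1 scale.
Proof. by move=> v; rewrite /scale scale1r. Qed.

Let scaleDr : right_distributive scale +%R.
Proof. by move=> r u v; rewrite /scale scalerDr. Qed.

Let scaleDl v : {morph scale^~ v : r s / r + s}.
Proof. by move=> r s; rewrite /scale rmorphD scalerDl. Qed.

HB.instance Definition _ :=
  GRing.Zmodule_isLmodule.Build R (realified V) scaleA scale1 scaleDr scaleDl.

End Realified.

(** * States on subalgebras: norm at the unit, extension, attained bounds *)

Section States.
Context {R : realType} {A : unitalCstarAlgType R}.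
Implicit Types (a b c h v x : A) (B : set A) (phi psi : A -> R[i]).

Definition star_subalgebra B :=
  closed_subalgebra B /\ forall b, B b -> B (star b).

Lemma star_subalgebraT : star_subalgebra [set: A].
Proof. by do 4![split=> //]; exact: closedT. Qed.

Lemma linear_onZ B phi (k : R[i]) a : linear_subspace B -> linear_on B phi ->
  B a -> phi (k *: a) = k * phi a.
Proof.
move=> [B0 _] lphi Ba; have /eqP := lphi 1 0 0 B0 B0.
rewrite scaler0 addr0 mul1r -subr_eq0 opprD addNKr oppr_eq0 => /eqP p0.
by rewrite -[k *: a]addr0 lphi // p0 addr0.
Qed.

Lemma linear_onD B phi a b : linear_on B phi -> B a -> B b ->
  phi (a + b) = phi a + phi b.
Proof. by move=> lphi Ba Bb; rewrite -[a in LHS]scale1r lphi // mul1r. Qed.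

Lemma linear_onB B phi a b : linear_subspace B -> linear_on B phi ->
  B a -> B b -> phi (a - b) = phi a - phi b.
Proof.
move=> sB lphi Ba Bb.
by rewrite addrC -scaleN1r lphi // mulN1r addrC.
Qed.

(** The imaginary part of [phi b] is minus the real part of [phi (i b)]. *)
Lemma linear_on_Re_inj B phi psi : linear_subspace B ->
  linear_on B phi -> linear_on B psi ->
  (forall b, B b -> complex.Re (phi b) = complex.Re (psi b)) ->
  forall b, B b -> phi b = psi b.
Proof.
move=> sB lphi lpsi e b Bb; apply/eqP; rewrite eq_complex e // eqxx /=.
have := e _ (subspaceZ 'i%C sB Bb).
rewrite (linear_onZ _ sB lphi) // (linear_onZ _ sB lpsi) //.
by case: (phi b) (psi b) => [p q] [p' q'] /=; rewrite !mul0r !mul1r !sub0r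
  => /oppr_inj ->.
Qed.

Section PositiveFunctional.
Variables (B : set A) (phi : A -> R[i]).
Hypotheses (sB : star_subalgebra B) (lphi : linear_on B phi)
  (pphi : positive_on B phi).

Let linB : linear_subspace B. Proof. by case: sB => -[]. Qed.
Let B1 : B cone. Proof. by case: sB => -[]. Qed.
Let Bstar b : B b -> B (star b). Proof. by case: sB => _; apply. Qed.

(** The root of [h] stays in [B], so [h] is of the form [star c ** c] with [c] in [B]. *)
Lemma positive_on_is_pos h : is_pos h -> B h -> 0 <= phi h.
Proof.
move=> hp Bh; have [c [[cc _] ch cB]] := is_pos_sqrt hp.
rewrite -ch -{1}cc; apply: pphi; apply: cB => //; by case: sB.
Qed.

(** Both [|h|] and [|h| - h] are positive elements of [B], so [phi] is real on them. *)
Lemma positive_on_sa h : star h = h -> B h -> complex.Im (phi h) = 0.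
Proof.
move=> hh Bh; have t1 : B ((rnorm h)%:C *: cone) by exact: subspaceZ.
have := positive_on_is_pos (is_pos_sub hh (lexx _)) (subspaceB linB t1 Bh).
have := positive_on_is_pos is_pos1 B1.
rewrite (linear_onB linB lphi) // (linear_onZ _ linB lphi) // !lecE /=.
case: (phi cone) (phi h) => [p q] [p' q'] /= /andP[/eqP -> _] /andP[/eqP + _].
by rewrite mulr0 mul0r addr0 sub0r => /eqP; rewrite oppr_eq0 => /eqP.
Qed.

Lemma positive_on_star b : B b -> phi (star b) = (phi b)^*%C.
Proof.
move=> Bb; have Bs := Bstar Bb.
have := @positive_on_sa (b + star b).
rewrite starD starK addrC (linear_onD lphi) // => /(_ erefl).
move=> /(_ (subspaceD linB Bb Bs)).
have := @positive_on_sa ('i%C *: (b - star b)).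
rewrite starZi starB starK -scalerN opprB (linear_onZ _ linB lphi);
  last exact: subspaceB.
rewrite (linear_onB linB lphi) // => /(_ erefl).
move=> /(_ (subspaceZ _ linB (subspaceB linB Bb Bs))).
case: (phi b) (phi (star b)) => [p q] [p' q'] /= Hre Him.
by congr Complex; lra.
Qed.

(** Rotating [b] by a phase makes [phi c = |phi b|]. The real part [h] of [c] is a contraction with
    [phi h = |phi b|], and [1 - h] is positive. *)
Lemma positive_on_bound b : B b -> rnorm b <= 1 ->
  complex.Re `|phi b| <= complex.Re (phi cone).
Proof.
move=> Bb b1; have [z0|zN0] := eqVneq (phi b) 0.
  rewrite z0 normr0 /=; have := positive_on_is_pos is_pos1 B1.
  by rewrite lecE => /andP[].
pose k := `|phi b| / phi b; pose c := k *: b.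
have Bc : B c by exact: subspaceZ.
have phic : phi c = `|phi b| by rewrite (linear_onZ _ linB lphi) // divfK.
have c1 : rnorm c <= 1.
  by rewrite rnormZ normrM normr_id normfV mulfV ?normr_eq0 // mul1r.
pose h := (2^-1)%:C *: (c + star c).
have hh : star h = h by rewrite starZr starD starK addrC.
have h1 : rnorm h <= 1.
  rewrite rnormZr ger0_norm ?invr_ge0 // ler_pdivrMl // mulr1.
  by apply: le_trans (ler_rnormD _ _) _; rewrite rnorm_star; lra.
have Bh : B h by apply: subspaceZ => //; apply: subspaceD => //; exact: Bstar.
have : 0 <= phi (cone - h).
  apply: positive_on_is_pos; last exact: subspaceB.
  by rewrite -[cone]scale1r -[1]/(1%:C); exact: is_pos_sub.
rewrite (linear_onB linB lphi) // (linear_onZ _ linB lphi); last first.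
  by apply: subspaceD => //; exact: Bstar.
rewrite (linear_onD lphi) ?positive_on_star //; last exact: Bstar.
have -> : phi c = (complex.Re `|phi b|)%:C by rewrite phic RRe_real ?ger0_real.
rewrite lecE => /andP[_].
by case: (phi cone) => [p q] /=; rewrite !mul0r !subr0; lra.
Qed.

(** The supremum is attained at the unit; this turns norm one into [phi cone = 1]. *)
Lemma norm_on_positive : norm_on B phi = (complex.Re (phi cone))%:E.
Proof.
have unitE b : (`|b| <= 1) = (rnorm b <= 1) by rewrite rnormE -lecR.
apply/eqP; rewrite eq_le; apply/andP; split.
  apply: ge_ereal_sup => x [b [Bb /=]]; rewrite unitE => b1 <-.
  by rewrite lee_fin positive_on_bound.
apply: ereal_sup_ubound; exists cone.
  by split=> //=; rewrite unitE rnorm1.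
have phi1 := positive_on_is_pos is_pos1 B1.
by rewrite ger0_norm.
Qed.

Lemma positive_on_stateP : is_state B phi <-> phi cone = 1.
Proof.
rewrite /is_state norm_on_positive; split=> [[_ _ [p1]]|->//].
have := positive_on_is_pos is_pos1 B1; rewrite lecE => /andP[/eqP p2 _].
by apply/eqP; rewrite eq_complex p1 p2 /= !eqxx.
Qed.

End PositiveFunctional.

Lemma stateP B phi : star_subalgebra B -> is_state B phi <->
  [/\ linear_on B phi, positive_on B phi & phi cone = 1].
Proof.
move=> sB; split=> [sphi|[l p u]]; last exact/(positive_on_stateP sB l p).
have [l p _] := sphi; split=> //; exact/(positive_on_stateP sB l p).
Qed.

(* The extension takes place over the reals: [G] prescribes real parts, and the
   state is recovered from its real part [f] as [f v - i f (i v)]. *)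
Lemma state_extension (G : set (realified A * R^o)) :
  positive_graph (fun v : realified A => is_pos ((v : A) + star (v : A))) G ->
  G (cone, 1) ->
  exists2 phi, is_state [set: A] phi
    & forall p, G p -> complex.Re (phi p.1) = p.2.
Proof.
(* The real cone [P] of elements with positive real part contains [i h] and [- i h] for self-adjoint
   [h], which forces [f (i h) = 0] below. *)
move=> gG G1; pose P (v : realified A) := is_pos ((v : A) + star (v : A)).
have PD (u v : realified A) : P u -> P v -> P (u + v).
  move=> Pu Pv; rewrite /P starD addrACA; exact: is_posD.
have PZ (r : R) (v : realified A) : 0 <= r -> P v -> P (r *: v).
  move=> r0 Pv; rewrite /P /= (_ : r *: v = r%:C *: (v : A)) //.
  by rewrite starZr -scalerDr; exact: is_posZ.
have [|f [fL fP fG]] := riesz_extension PD PZ gG.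
  move=> v; pose t := rnorm (v : A).
  exists (t *: ((cone, 1) : realified A * R^o)).
    have [G0 GL _] := gG; rewrite -[_ *: _]addr0; exact: GL.
  rewrite /P /= (_ : t *: (cone : realified A) = t%:C *: (cone : A)) //.
  rewrite starB starZr star1 addrACA -opprD -scalerrD.
  apply: is_pos_sub; first by rewrite starD starK addrC.
  by apply: le_trans (ler_rnormD _ _) _; rewrite rnorm_star.
have f0 : f 0 = 0 by have := fG 0; case: gG => G0 _ _ /(_ G0).
have fZ t (u : A) : f (t%:C *: u) = t * f u.
  by have := fL t u 0; rewrite f0 !addr0.
have fD (u v : A) : f (u + v) = f u + f v.
  by have := fL 1 u v; rewrite scale1r mul1r.
have fi h : star h = h -> f ('i%C *: h) = 0.
  move=> hh; apply/eqP; rewrite eq_le; apply/andP; split.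
    rewrite -oppr_ge0 -mulN1r -fZ; apply: fP.
    by rewrite /P starZr starZi hh scalerN subrr; exact: is_pos0.
  by apply: fP; rewrite /P starZi hh subrr; exact: is_pos0.
pose phi (v : A) : R[i] := Complex (f v) (- f ('i%C *: v)).
exists phi => //; apply/stateP; first exact: star_subalgebraT.
split.
- move=> [x y] u v _ _; rewrite /phi.
  have cE (w : A) : (x +i* y) *: w = x%:C *: w + y%:C *: ('i%C *: w).
    by rewrite scalerA -scalerDl; congr (_ *: _); simpc.
  have ci : 'i%C *: ((x +i* y) *: u) = x%:C *: ('i%C *: u) + (- y)%:C *: u.
    by rewrite !scalerA -scalerDl; congr (_ *: _); simpc.
  rewrite scalerDr ci cE !fD !fZ; simpc; congr Complex; ring.
- move=> b _; rewrite /phi (fi _ (star_mul_self b)) oppr0 lecE /= eqxx /=.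
  apply: fP; rewrite /P star_mul_self.
  by apply: is_posD; exact: is_pos_star_mul.
- rewrite /phi fi ?star1 // oppr0.
  by have /= -> := fG _ G1.
Qed.

Lemma is_pos_scalar (r : R) :
  (cone : A) != 0 -> is_pos (r%:C *: (cone : A)) -> 0 <= r.
Proof.
move=> n0 rp; have [//|r0] := leP 0 r; exfalso.
have rn : is_pos (- (r%:C *: (cone : A))).
  by rewrite -scaleNr -rmorphN; apply: is_posZ is_pos1; rewrite oppr_ge0 ltW.
have /eqP := is_pos_anti rp rn.
rewrite scaler_eq0 (negPf n0) orbF => /eqP[rE].
by rewrite rE ltxx in r0.
Qed.

(** Let [m] be the least [t] with [t - a] positive; the infimum is attained by [is_pos_limit]. The
    state extends the functional sending [s + t a] to [s + t m], for real [s] and [t]. *)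
Lemma state_attaining_max a : (cone : A) != 0 -> star a = a ->
  exists psi (m : R), [/\ is_state [set: A] psi, psi a = m%:C
    & is_pos (m%:C *: cone - a)].
Proof.
move=> n0 aa; pose S := [set t : R | is_pos (t%:C *: cone - a)].
have S0 : S !=set0 by exists (rnorm a); exact: is_pos_sub.
have Slb : has_lbound S.
  exists (- rnorm a) => t /= St; rewrite -subr_ge0 opprK.
  apply: is_pos_scalar => //; rewrite scalerrD -[t%:C *: _](subrK a) -addrA.
  apply: is_posD => //; rewrite -[a]opprK addrC; apply: is_pos_sub.
    by rewrite starN aa.
  by rewrite !rnormN.
pose m := inf S.
have mp : is_pos (m%:C *: cone - a).
  apply: is_pos_limit => e e0.
  have [t St tm] := inf_adherent e0 (conj S0 Slb).
  have -> : e%:C *: cone + (m%:C *: cone - a)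
      = (m + e - t)%:C *: cone + (t%:C *: cone - a).
    by rewrite !addrA -!scalerrD subrK [e + _]addrC.
  apply: is_posD => //; apply: is_posZ is_pos1; rewrite subr_ge0 ltW //.
pose G : set (realified A * R^o) :=
  [set p | exists s t : R, p = (s%:C *: (cone : A) + t%:C *: a, s + t * m)].
have [||psi psis psiG] := @state_extension G.
- split.
  + by exists 0, 0; rewrite !scale0r mul0r !addr0.
  + move=> r _ _ [s [t ->]] [s' [t' ->]]; exists (r * s + s'), (r * t + t').
    congr pair; last first.
      change (r * (s + t * m) + (s' + t' * m) = r * s + s' + (r * t + t') * m).
      ring.
    change (r%:C *: (s%:C *: cone + t%:C *: a) + (s'%:C *: cone + t'%:C *: a)
      = (r * s + s')%:C *: cone + (r * t + t')%:C *: a :> A).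
    by rewrite !scalerrD !scalerrM addrACA -scalerDr.
  + move=> _ [s [t ->]] /= up.
    (* The cone condition concerns the sum with the adjoint, which is twice this self-adjoint
       element. *)
    have {}up : is_pos (s%:C *: cone + t%:C *: a).
      have -> : s%:C *: cone + t%:C *: a = (2^-1)%:C *:
          (s%:C *: cone + t%:C *: a + star (s%:C *: cone + t%:C *: a)).
        rewrite starD !starZr star1 aa -mulr2n -(scaler_nat 2 (_ + _)) scalerA.
        by rewrite -(rmorph_nat (real_complex R) 2) -rmorphM mulVf // scale1r.
      by apply: is_posZ => //; rewrite invr_ge0.
    (* If [t >= 0], add [t (m - a)] to [s + t a]. If [t < 0], division by [- t] shows that [- s / t]
       lies in [S], hence is at least [m]. *)
    have [t0|t0] := leP 0 t.
      apply: is_pos_scalar => //.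
      have -> : (s + t * m)%:C *: cone
          = s%:C *: cone + t%:C *: a + t%:C *: (m%:C *: cone - a).
        by rewrite scalerBr -addrA [_ *: a + _]addrC subrK -scalerrM -scalerrD.
      by apply: is_posD => //; exact: is_posZ.
    have tN : 0 <= - t^-1 by rewrite oppr_ge0 invr_le0 ltW.
    have : S (- t^-1 * s).
      rewrite /S /=; have := is_posZ tN up.
      rewrite scalerDr -!scalerrM (mulNr _ t) mulVf ?lt_eqF // rmorphN scaleN1r //.
    move=> /(ge_inf Slb); rewrite -/m => ms.
    have : t * (- t^-1 * s) <= t * m by rewrite ler_wnM2l // ltW.
    by rewrite mulrA mulrN divff ?lt_eqF // mulN1r; lra.
- by exists 1, 0; rewrite scale1r scale0r mul0r !addr0.
exists psi, m; split=> //.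
have /(stateP _ star_subalgebraT)[l p _] := psis.
have Ga : G (a, m) by exists 0, 1; rewrite scale1r scale0r mul1r !add0r.
apply/eqP; rewrite eq_complex /= (psiG _ Ga) eqxx /=.
by rewrite (positive_on_sa star_subalgebraT l p).
Qed.

End States.

(** * Closed linear spans *)

Section LinearSpans.
Context {R : realType} {V : normedModType R[i]}.
Implicit Types (S M : set V).

Lemma linear_span_subspace S : linear_subspace (smallest linear_subspace S).
Proof.
split=> [M [[]]//|c u v Su Sv M SM]; have [[_ ML] _] := SM.
by apply: ML; [exact: Su|exact: Sv].
Qed.

Lemma sub_closed_linear_span S : S `<=` closed_linear_span S.
Proof. by move=> s Ss; apply: subset_closure => M [_]; apply. Qed.

Lemma closed_linear_span_subspace S : linear_subspace (closed_linear_span S).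
Proof.
have [L0 LL] := linear_span_subspace S; split; first exact: subset_closure.
move=> c u v /closureP Su /closureP Sv; apply/closureP => e e0.
pose k := complex.Re `|c|.
have k0 : 0 <= k by rewrite -lecR RRe_real ?normr_ge0 // ger0_real.
have d0 : 0 < e / (k + 1) by rewrite divr_gt0 // ltr_wpDl.
have dE : (k + 1) * (e / (k + 1)) = e.
  by rewrite mulrC divfK // gt_eqF // ltr_wpDl.
set d := e / (k + 1) in d0 dE.
have [u' Lu uu] := Su _ (divr_gt0 d0 (ltr0n _ 2)).
have [v' Lv vv] := Sv _ (divr_gt0 e0 (ltr0n _ 2)).
exists (c *: u' + v'); first exact: LL.
rewrite opprD addrACA -scalerBr; apply: le_lt_trans (ler_rnormD _ _) _.
rewrite rnormZ -/k.
have : k * rnorm (u - u') <= k * (d / 2) by rewrite ler_wpM2l // ltW.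
rewrite mulrDl mul1r in dE; lra.
Qed.

Lemma closed_linear_span_min S M : linear_subspace M -> closed M ->
  S `<=` M -> closed_linear_span S `<=` M.
Proof.
move=> lM clM SM; apply: subset_trans clM; apply: closureS.
by move=> s; apply.
Qed.

(** The twist [g] of the scalars covers the conjugate-linear [star] along with linear maps such as
    right multiplication. *)
Lemma closed_linear_span_map S T (f : V -> V) (g : R[i] -> R[i]) (K : R) :
  (forall c u v, f (c *: u + v) = g c *: f u + f v) ->
  (forall v, rnorm (f v) <= K * rnorm v) ->
  (forall s, S s -> closed_linear_span T (f s)) ->
  forall v, closed_linear_span S v -> closed_linear_span T (f v).
Proof.
move=> fL fK fS; have [T0 TL] := closed_linear_span_subspace T.
have f0 : f 0 = 0.
  apply/rnorm_eq0/eqP; rewrite eq_le rnorm_ge0 andbT.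
  by apply: le_trans (fK 0) _; rewrite rnorm0 mulr0.
have fB u v : f (u - v) = f u - f v.
  have fN : g (-1) *: f v = - f v.
    by apply/eqP; rewrite -addr_eq0 -fL scaleN1r addNr f0.
  by rewrite addrC -scaleN1r fL fN addrC.
apply: (@closed_linear_span_min S [set v | closed_linear_span T (f v)]) => //.
  by split=> [|c u v Tu Tv] /=; [rewrite f0|rewrite fL; exact: TL].
apply/closedP => v Tv /=; apply: ((closedP _).1 (@closed_closure _ _)) => e e0.
have K0 : 0 < `|K| + 1 by rewrite ltr_wpDl.
have [w Tw vw] := Tv _ (divr_gt0 e0 K0); exists (f w) => //.
rewrite -fB; apply: le_lt_trans (fK _) _.
apply: (@le_lt_trans _ _ ((`|K| + 1) * rnorm (v - w))).
  by rewrite ler_wpM2r ?rnorm_ge0 // ler_wpDr // ler_norm.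
by rewrite mulrC -ltr_pdivlMr.
Qed.

End LinearSpans.

(** * Ternary subspaces, their coefficient algebras, and states on these *)

Section TernarySubspaces.
Context {R : realType} {A : unitalCstarAlgType R} {E : hilbertModType A}.
Variables (F : set E) (z : E).
Hypotheses (ternF : ternary F) (Fz : F z) (zz : inner z z = cone).

(** For [b] in the span, [<x, y> b = <x, y b>] stays there by ternarity, and bounded linearity
    extends this to all left factors. The unit is [<z, z>]. *)
Lemma inner_span_star_subalgebra : star_subalgebra (inner_span F).
Proof.
have lin := closed_linear_span_subspace [set inner x y | x in F & y in F].
have cl : closed (inner_span F) by exact: closed_closure.
have sub x y : F x -> F y -> inner_span F (inner x y).
  by move=> Fx Fy; apply: sub_closed_linear_span; exists x => //; exists y.
split; last first.
  apply: (@closed_linear_span_map _ A _ _ star (fun c => c^*%C) 1).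
  - by move=> c a b; rewrite starD starZ.
  - by move=> a; rewrite mul1r rnorm_star.
  - by move=> _ [x Fx [y Fy <-]]; rewrite star_inner; exact: sub.
split=> //; first by rewrite -zz; exact: sub.
move=> a b Ba Bb; move: a Ba.
apply: (@closed_linear_span_map _ A _ _ (fun a => cmul a b) id (rnorm b)).
- by move=> c u v; rewrite cmulDl cmulZl.
- by move=> a; rewrite mulrC rnormM.
- move=> _ [x Fx [y Fy <-]]; rewrite -inner_ract; apply: sub => //.
  by case: ternF => _ _; apply.
Qed.

Lemma mod_abs_inner_span x : F x ->
  is_pos (mod_abs x) /\ inner_span F (mod_abs x).
Proof.
move=> Fx; have /cstar_posP/cstar_sqrtP[xp _ xB] := inner_pos x.
split=> //; apply: (xB (inner_span F)).
  by case: inner_span_star_subalgebra.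
by apply: sub_closed_linear_span; exists x => //; exists x.
Qed.

(** One has [<z h, z h> = h <z, z> h = h^2], whose positive root is [h]. *)
Lemma mod_abs_ract h : is_pos h -> mod_abs (ract z h) = h.
Proof.
move=> hp; have [hh _] := hp; rewrite /mod_abs inner_ract.
by rewrite -star_inner inner_ract zz cmul1l hh cstar_sqrt_sqr.
Qed.

End TernarySubspaces.

(** This is nonnegativity of the variance: [phi] of [(h - phi h)^2] is [phi (h^2) - (phi h)^2]. *)
Lemma state_mod_abs_le {R : realType} {A : unitalCstarAlgType R} (B : set A)
    (phi : A -> R[i]) (h : A) : star_subalgebra B -> is_state B phi ->
  is_pos h -> B h -> phi h <= sqrtC (phi (h ** h)).
Proof.
move=> sB /(stateP _ sB)[l p u] hp Bh; have [hh _] := hp.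
have [[linB _ B1 BM] _] := sB.
have h0 := positive_on_is_pos sB p hp Bh.
have hE : phi h = (complex.Re (phi h))%:C by rewrite RRe_real // ger0_real.
set t := complex.Re (phi h) in hE.
pose g := h - t%:C *: cone.
have Bg : B g by apply: subspaceB => //; exact: subspaceZ.
have gg : star g = g by rewrite starB starZr star1 hh.
have : 0 <= phi (g ** g).
  by apply: (positive_on_is_pos sB p); [exact: is_pos_sqr|exact: BM].
have -> : g ** g = (t ^+ 2)%:C *: cone - ((2 * t)%:C *: h - h ** h).
  rewrite cmulBl !cmulBr !cmulZl !cmulZr !cmul1l cmul1r -scalerrM -expr2.
  rewrite !opprB mulr_natl mulr2n scalerrD opprD.
  by rewrite [LHS](AC (2*2) (3*(1*(2*4)))) /=.
have Bh2 := BM _ _ Bh Bh; have B2h := subspaceZ (2 * t)%:C linB Bh.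
rewrite !(linear_onB linB l) //; last 2 first.
- exact: subspaceZ.
- exact: subspaceB.
rewrite !(linear_onZ _ linB l) // u hE mulr1 -rmorphM /= => tt.
have {}tt : t%:C ^+ 2 <= phi (h ** h).
  move: tt; rewrite opprB addrCA -rmorphB (_ : _ - _ = - t ^+ 2); last by ring.
  by rewrite rmorphN subr_ge0 -rmorphXn.
have t0 : 0 <= t%:C by rewrite -hE.
rewrite -(sqrCK t0) ler_sqrtC // nnegrE; first exact: exprn_ge0.
exact: le_trans (exprn_ge0 2 t0) tt.
Qed.

(** With [s] the root of [h], [|h| h - h^2 = s (|h| - h) s] is positive, so
    [phi (h^2) <= |h| phi h]. *)
Lemma state_sqr_eq0 {R : realType} {A : unitalCstarAlgType R} (B : set A)
    (phi : A -> R[i]) (h : A) : star_subalgebra B -> is_state B phi ->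
  is_pos h -> B h -> phi h = 0 -> phi (h ** h) = 0.
Proof.
move=> sB /(stateP _ sB)[l p u] hp Bh ph; have [hh _] := hp.
have [[linB _ B1 BM] _] := sB.
have [s [[ss _] s2 sh]] := is_pos_sqrt_commute hp (erefl (h ** h)).
apply/eqP; rewrite eq_le; apply/andP; split; last first.
  by apply: (positive_on_is_pos sB p); [exact: is_pos_sqr|exact: BM].
have : 0 <= phi ((rnorm h)%:C *: h - h ** h).
  apply: (positive_on_is_pos sB p); last first.
    by apply: subspaceB => //; [exact: subspaceZ|exact: BM].
  have -> : (rnorm h)%:C *: h - h ** h
      = star s ** ((rnorm h)%:C *: cone - h) ** s.
    rewrite ss cmulBr cmulBl cmulZr cmulZl cmul1r s2 -sh -cmulA s2 //.
  by apply: is_pos_conj; exact: is_pos_sub.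
rewrite (linear_onB linB l) ?(linear_onZ _ linB l) //; last 2 first.
- exact: subspaceZ.
- exact: BM.
by rewrite ph mulr0 sub0r oppr_ge0.
Qed.

(** The unit lies in [B], so the restriction still has norm one. *)
Lemma state_restrict {R : realType} {A : unitalCstarAlgType R} (B : set A)
    (phi : A -> R[i]) : star_subalgebra B -> is_state [set: A] phi ->
  is_state B phi.
Proof.
move=> sB /(stateP _ star_subalgebraT)[l p u]; apply/stateP => //.
by split=> // [c a b _ _|b _]; [exact: l|exact: p].
Qed.

(** Take [x = z h]: the bound reads [phi h <= M psi (h^2)^(1/2)], and [psi h = 0] gives
    [psi (h^2) = 0]. *)
Lemma dominated_state_eq0 {R : realType} {A : unitalCstarAlgType R}
    {E : hilbertModType A} (F : set E) (z : E) (M : R)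
    (phi psi : A -> R[i]) : ternary F -> F z -> inner z z = cone ->
  is_state [set: A] phi -> is_state (inner_span F) psi ->
  (forall x, F x ->
    phi (mod_abs x) <= M%:C * sqrtC (psi (mod_abs x ** mod_abs x))) ->
  forall h, is_pos h -> inner_span F h -> psi h = 0 -> phi h = 0.
Proof.
move=> ternF Fz zz /(stateP _ star_subalgebraT)[l p _] spsi phiM h hp Fh psih.
have sB := inner_span_star_subalgebra ternF Fz zz.
have Fzh : F (ract z h) by case: ternF => _ _; apply.
have := phiM _ Fzh; rewrite mod_abs_ract // (state_sqr_eq0 sB) //.
rewrite sqrtC0 mulr0 => phi0; apply/eqP; rewrite eq_le phi0 /=.
exact: (positive_on_is_pos star_subalgebraT p).
Qed.

(** Apply [phi], using [phi (a + star a) = 2 Re (phi a)]. *)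
Lemma state_shift_ge0 {R : realType} {A : unitalCstarAlgType R} (B : set A)
    (phi : A -> R[i]) (m : R) (a : A) : star_subalgebra B -> is_state B phi ->
  B a -> is_pos (m%:C *: cone + (a + star a)) ->
  0 <= m + 2 * complex.Re (phi a).
Proof.
move=> sB /(stateP _ sB)[l p u] Ba mp.
have [[linB _ B1 _] Bs] := sB; have Bsa := Bs _ Ba.
have Baa := subspaceD linB Ba Bsa.
have Bm : B (m%:C *: cone) by exact: subspaceZ.
have := positive_on_is_pos sB p mp (subspaceD linB Bm Baa).
rewrite (linear_onD l) // (linear_onZ _ linB l) // (linear_onD l) // u mulr1.
rewrite (positive_on_star sB l p) // lecE => /andP[_].
by case: (phi a) => [q r] /=; lra.
Qed.

(** * Module independence against independence of the coefficient algebras *)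

Theorem theorem2p16 (R : realType) (A : unitalCstarAlgType R)
    (E : hilbertModType A) (E1 E2 : set E)
    (ternary_E1 : ternary E1) (ternary_E2 : ternary E2)
    (z : E) (E1z : E1 z) (E2z : E2 z) (inner_z : inner z z = cone) :
  module_independent E1 E2 <->
  cstar_independent (inner_span E1) (inner_span E2).
Proof.
have sA1 := inner_span_star_subalgebra ternary_E1 E1z inner_z.
have sA2 := inner_span_star_subalgebra ternary_E2 E2z inner_z.
split=> [[m [M [_ _ modind]]]|cind]; last first.
  exists 1, 1; split=> // phi1 phi2 s1 s2.
  have [phi [sphi e1 e2]] := cind _ _ s1 s2.
  exists phi; split=> // x Ex; rewrite !mul1r.
  - have [xp xB] := mod_abs_inner_span ternary_E1 E1z inner_z Ex.
    by rewrite e1 // lexx /=; exact: state_mod_abs_le sA1 s1 xp xB.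
  - have [xp xB] := mod_abs_inner_span ternary_E2 E2z inner_z Ex.
    by rewrite e2 // lexx /=; exact: state_mod_abs_le sA2 s2 xp xB.
move=> phi1 phi2 s1 s2.
have [l1 p1 u1] := (stateP _ sA1).1 s1.
have [l2 p2 u2] := (stateP _ sA2).1 s2.
have [[lin1 _ one1 _] star1] := sA1; have [[lin2 _ one2 _] star2] := sA2.
(* An algebra carrying a state is nonzero, as [state_attaining_max] demands. *)
have n0 : cone != 0 :> A.
  apply/eqP => c0; have := linear_onZ 0 lin1 l1 one1.
  by rewrite scale0r -c0 u1 mul0r => /eqP; rewrite oner_eq0.
(* An element may split in several ways, since both algebras contain the unit. The graph takes all
   splittings; their consistency is part of the positivity proved below. *)
pose G : set (realified A * R^o) := [set p | exists a b,
  [/\ inner_span E1 a, inner_span E2 b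
    & p = (a + b, complex.Re (phi1 a) + complex.Re (phi2 b))]].
have phi1_0 : phi1 0 = 0.
  by rewrite -(scale0r cone) (linear_onZ _ lin1 l1) // mul0r.
have phi2_0 : phi2 0 = 0.
  by rewrite -(scale0r cone) (linear_onZ _ lin2 l2) // mul0r.
have [A1_0 _] := lin1; have [A2_0 _] := lin2.
have [||phi sphi phiG] := @state_extension R A G.
- split.
  + by exists 0, 0; split=> //; rewrite phi1_0 phi2_0 !addr0.
  + move=> t _ _ [a [b [Ba Bb ->]]] [a' [b' [Ba' Bb' ->]]].
    exists (t%:C *: a + a'), (t%:C *: b + b'); split.
    * exact: subspaceD lin1 (subspaceZ _ lin1 Ba) Ba'.
    * exact: subspaceD lin2 (subspaceZ _ lin2 Bb) Bb'.
    congr pair; last first.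
      rewrite l1 // l2 // -[LHS]/(t * (complex.Re (phi1 a) + complex.Re (phi2 b))
        + (complex.Re (phi1 a') + complex.Re (phi2 b'))).
      by case: (phi1 a) (phi1 a') (phi2 b) (phi2 b')
        => [? ?] [? ?] [? ?] [? ?] /=; ring.
    change (t%:C *: (a + b) + (a' + b') = t%:C *: a + a' + (t%:C *: b + b')).
    by rewrite scalerDr addrACA.
  + move=> _ [a [b [Ba Bb ->]]] /= abp.
    have sym (c : A) : star (- (c + star c)) = - (c + star c).
      by rewrite starN starD starK addrC.
    (* Here [m1] and [m2] are the [alpha] and [beta] of the outline, for the self-adjoint elements
       [a + star a] and [b + star b]. *)
    have [psi1 [m1 [spsi1 psi1m m1p]]] := state_attaining_max n0 (sym a).
    have [psi2 [m2 [spsi2 psi2m m2p]]] := state_attaining_max n0 (sym b).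
    rewrite opprK in m1p; rewrite opprK in m2p.
    have shift (k : R) (psi : A -> R[i]) (c : A) : is_state [set: A] psi ->
        psi (- (c + star c)) = k%:C ->
        psi (k%:C *: cone + (c + star c)) = 0.
      move=> /(stateP _ star_subalgebraT)[l _ u] pc; have [[lin _ _ _] _] :=
        @star_subalgebraT R A.
      rewrite -[c + star c]opprK (linear_onB lin l) //.
      by rewrite (linear_onZ _ lin l) // u mulr1 pc subrr.
    have inS (B : set A) (k : R) (c : A) : star_subalgebra B -> B c ->
        B (k%:C *: cone + (c + star c)).
      move=> [[lin _ one _] st] Bc; apply: subspaceD => //.
        exact: subspaceZ.
      by apply: subspaceD => //; exact: st.
    have spsi1' := state_restrict sA1 spsi1.
    have spsi2' := state_restrict sA2 spsi2.
    have [phi [sphi phi_1 phi_2]] := modind _ _ spsi1' spsi2'.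
    have phi_x1 : phi (m1%:C *: cone + (a + star a)) = 0.
      apply: (dominated_state_eq0 (M := M) ternary_E1 E1z inner_z sphi
        spsi1') => //.
      + by move=> x /phi_1/andP[].
      + exact: (inS _ m1 a sA1 Ba).
      + exact: shift.
    have phi_x2 : phi (m2%:C *: cone + (b + star b)) = 0.
      apply: (dominated_state_eq0 (M := M) ternary_E2 E2z inner_z sphi
        spsi2') => //.
      + by move=> x /phi_2/andP[].
      + exact: (inS _ m2 b sA2 Bb).
      + exact: shift.
    have [lphi pphi uphi] := (stateP _ star_subalgebraT).1 sphi.
    have := positive_on_is_pos star_subalgebraT pphi abp I.
    have [[lin _ _ _] _] := @star_subalgebraT R A.
    (* Since [phi] kills both shifted elements, its value here is [- (m1 + m2)], so
       [m1 + m2 <= 0]. *)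
    have -> : a + b + star (a + b) = (m1%:C *: cone + (a + star a))
        + (m2%:C *: cone + (b + star b)) - (m1 + m2)%:C *: cone.
      by rewrite starD scalerrD [X in _ = X - _]addrACA [X in _ = X - _]addrC
        addrK addrACA.
    rewrite (linear_onB lin lphi) // (linear_onD lphi) // phi_x1 phi_x2.
    rewrite (linear_onZ _ lin lphi) // uphi mulr1 addr0 sub0r oppr_ge0 lecR.
    (* The lower bounds [- m1 / 2] for [Re (phi1 a)] and [- m2 / 2] for [Re (phi2 b)] add up to a
       nonnegative number. *)
    have := state_shift_ge0 sA1 s1 Ba m1p.
    have := state_shift_ge0 sA2 s2 Bb m2p; lra.
- exists cone, 0; split=> //; rewrite u1 phi2_0 !addr0 //.
have [lphi _ _] := (stateP _ star_subalgebraT).1 sphi.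
exists phi; split=> //.
(* Real parts determine a linear functional, and on each algebra they are read off [G] with the
   other summand zero. *)
- apply: (linear_on_Re_inj lin1 _ l1) => [c u v _ _|b Bb]; first exact: lphi.
  have : G (b, complex.Re (phi1 b)).
    by exists b, 0; split=> //; rewrite phi2_0 !addr0.
  by move=> /phiG.
- apply: (linear_on_Re_inj lin2 _ l2) => [c u v _ _|b Bb]; first exact: lphi.
  have : G (b, complex.Re (phi2 b)).
    by exists 0, b; split=> //; rewrite phi1_0 !add0r.
  by move=> /phiG.
Qed.
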